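(* Let $G$ be an expression graph and let $S : A_1(n_1, A_2(n_2, \ldots, A_m(n_m, \cdot)))$ be a sequence of $m$ applications of axioms of equivalence that is a semantics-preserving composition when applied to $G$. If $G' = S(G)$, then $G \equiv G'$, i.e. $G$ and $G'$ are equivalent (have identical semantics) under the axiom system used in $S$.
   Context: Expression graphs. An expression graph $G = \langle n_{root}, N, E\rangle$ is a directed dataflow graph with labelled nodes: each node $n \in N$ models an n-ary operation or an input operand (a node with no predecessor is an input value), and a directed edge $e_{n_1,n_2} : n_1 \to n_2$ connects the producer $n_1$ of a value to a node $n_2$ consuming it. The unique root $n_{root}$ is the only node without successor and produces the output value of the computation. There are no dangling edges and no unconnected nodes. Semantics. A fixed interpretation of the operators is given, so every expression graph computes an output value from the values assigned to its input variables. Two expression graphs are (semantically) equivalent, written $G \equiv G'$, if they always produce the same output for all possible inputs (identical semantics). In contrast, $G = G'$ denotes complete structural identity (same graph structure and same node labels). Graph patterns. A graph pattern $P = \langle G_P, M_n, M_e\rangle$ is an unambiguous structural description of a (sub)graph $G_P$ that can be deterministically matched in any expression graph $G$: $M_n$ assigns to each node of $G_P$ the set of node values accepted as a match in $G$, and $M_e$ assigns to each pair of nodes of $G_P$ the edges that must be present between their matches; the pattern matches if all nodes and all edges of $G_P$ have matches and there are no other edges in $G$ between matched nodes. When a pattern models a rewrite, $M_n, M_e$ output the rewritten nodes and edges. Axioms. An axiom of equivalence $A : \langle P_{match}, P_{replace}\rangle$, with $P_{match}, P_{replace}$ graph patterns, is a semantics-preserving rewrite rule: whenever $P_{match}$ succeeds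 on the subgraph of $G$ rooted at node $n$, the application $A(n,G)$, obtained by applying $P_{replace}$ at $n$, is again an expression graph, with semantics identical to that of $G$. Composition. The sequence $S : A_1(n_1, A_2(n_2, \ldots, A_m(n_m, G)))$ (so $A_m$ is applied first, at node $n_m$ of $G$, and $A_1$ last) is a semantics-preserving composition if for each application $G_j = A_i(n_i, G_i)$ occurring in $S$, $P_{match}^{A_i}$ succeeds on the subgraph with root $n_i$ in $G_i$ and $G_j$ is obtained by applying $P_{replace}^{A_i}$ to $n_i$. $S(G)$ denotes the resulting graph. *)

(* Defs.v *)
From HB Require Import structures.
From mathcomp Require Import all_boot finmap.

Set Implicit Arguments.
Unset Strict Implicit.
Unset Printing Implicit Defensive.

Local Open Scope fset_scope.
Local Open Scope fmap_scope.

(* Variables and constants are the labels of input values; operators label the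
   nodes that have predecessors. *)
Record signature := Signature {
  var : Type;
  cst : Type;
  op : Type;
  arity : op -> nat;
  arity_gt0 : forall f, 0 < arity f }.

Inductive label (Sg : signature) :=
| Var of var Sg
| Cst of cst Sg
| Op of op Sg.

Arguments Var {Sg} _.
Arguments Cst {Sg} _.
Arguments Op {Sg} _.

Definition label_arity (Sg : signature) (l : label Sg) : nat :=
  if l is Op f then arity f else 0.

(* Operators are total on a single carrier, of which values of several types
   (scalars, vectors, matrices, undefined results) may be elements; [possible]
   says which values an input variable may receive. *)
Record interpretation (Sg : signature) := Interpretation {
  value : Type;
  possible : var Sg -> value -> Prop;
  cst_value : cst Sg -> value;
  op_value : forall f : op Sg, (arity f).-tuple value -> value }.

(* Nodes are named by natural numbers and N is the domain of [lab], so that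
   Leibniz equality of graphs is structural identity.  The edge (a, b, i) says
   that a produces the i-th operand of b: the position is needed for
   non-commutative operators and for a node used twice by the same consumer. *)
Record graph (Sg : signature) := Graph {
  out_root : nat;
  lab : {fmap nat -> label Sg};
  edges : {fset nat * nat * nat} }.

Definition nodes (Sg : signature) (G : graph Sg) : {fset nat} := domf (lab G).

Definition node_label (Sg : signature) (G : graph Sg) (v : nodes G) : label Sg :=
  lab G v.

Definition positions (Sg : signature) (G : graph Sg) (a b : nat) : {fset nat} :=
  [fset e.2 | e in edges G & e.1 == (a, b)].

Definition adj (Sg : signature) (G : graph Sg) : rel (nodes G) :=
  fun a b => positions G (val a) (val b) != fset0.

Definition live (Sg : signature) (G : graph Sg) : {fset nat} :=
  [fset val v | v in {: nodes G}
     & [exists r : nodes G, (val r == out_root G) && connect (@adj _ G) v r]].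

Record expr_graph (Sg : signature) (G : graph Sg) : Prop := ExprGraph {
  eg_root : out_root G \in nodes G;
  eg_no_dangling : forall e, e \in edges G ->
    (e.1.1 \in nodes G) && (e.1.2 \in nodes G);
  eg_unique_sink : forall v : nodes G,
    (forall w : nodes G, ~~ adj v w) <-> val v = out_root G;
  eg_connected : nodes G `<=` live G;
  eg_acyclic : forall v w : nodes G, adj v w -> ~~ connect (@adj _ G) w v;
  eg_operand_bound : forall (u v : nodes G) i,
    (val u, val v, i) \in edges G -> i < label_arity (node_label v);
  eg_operand : forall (v : nodes G) i, i < label_arity (node_label v) ->
    exists! u : nodes G, (val u, val v, i) \in edges G }.

Section Semantics.
Variables (Sg : signature) (I : interpretation Sg).

Definition possible_input (env : var Sg -> value I) : Prop :=
  forall x, possible x (env x).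

Inductive computes (G : graph Sg) (env : var Sg -> value I) :
  nodes G -> value I -> Prop :=
| computes_var v x : node_label v = Var x -> computes env v (env x)
| computes_cst v c : node_label v = Cst c -> computes env v (cst_value I c)
| computes_op v f (u : (arity f).-tuple (nodes G))
    (a : (arity f).-tuple (value I)) :
    node_label v = Op f ->
    (forall i, (val (tnth u i), val v, val i) \in edges G) ->
    (forall i, computes env (tnth u i) (tnth a i)) ->
    computes env v (op_value a).

Definition output (G : graph Sg) (env : var Sg -> value I) (a : value I) : Prop :=
  exists2 v : nodes G, val v = out_root G & computes env v a.

Definition equivalent (G G' : graph Sg) : Prop :=
  [/\ expr_graph G, expr_graph G' &
      forall env, possible_input env ->
        forall a, output G env a <-> output G' env a].

End Semantics.

Lemma edge_adj Sg (G : graph Sg) (u v : nodes G) i : (val u, val v, i) \in edges G -> adj u v.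
Proof.
move=> h; apply/fset0Pn; exists i; apply/imfsetP; exists (val u, val v, i) => //.
by rewrite inE /= h eqxx.
Qed.

Lemma tuple_choice T n (P : 'I_n -> T -> Prop) : (forall i, exists x, P i x) ->
  exists s : n.-tuple T, forall i, P i (tnth s i).
Proof.
elim: n P => [|n IHn] P hP; first by exists [tuple] => -[].
have [x hx] := hP ord0; have [s hs] := IHn (fun i => P (lift ord0 i)) (fun i => hP _).
exists [tuple of x :: s] => i; case: (unliftP ord0 i) => [j|] ->; last by [].
by rewrite tnthS.
Qed.

Lemma computes_exists Sg (I : interpretation Sg) (G : graph Sg) env (v : nodes G) :
  expr_graph G -> exists a, computes (I := I) env v a.
Proof.
move=> hG; have [k] := ubnP #|[pred w | connect (@adj _ G) w v]|.
elim: k v => // k IH v hk; case el: (node_label v) => [x|c|f].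
- by exists (env x); apply: computes_var.
- by exists (cst_value I c); apply: computes_cst.
have hop (i : 'I_(arity f)) :
  exists u : nodes G, ((val u, val v, val i) \in edges G) /\ exists a, computes (I := I) env u a.
  have hi : i < label_arity (node_label v) by rewrite el.
  have [u [hu _]] := eg_operand hG hi.
  exists u; split=> //; apply: IH.
  rewrite ltnS in hk; apply: leq_trans hk.
  apply: proper_card; apply/properP; split.
    apply/subsetP=> w; rewrite !inE => h; apply: connect_trans h _.
    exact/connect1/(edge_adj hu).
  exists v; rewrite !inE ?connect0 //.
  by apply: (eg_acyclic hG); apply: edge_adj hu.
have [u hu] := tuple_choice hop.
have [a ha] := tuple_choice (fun i => proj2 (hu i)).
by exists (op_value a); apply: computes_op el (fun i => proj1 (hu i)) ha.
Qed.

Lemma computes_unique Sg (I : interpretation Sg) (G : graph Sg) env (v : nodes G) a b :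
  expr_graph G -> computes (I := I) env v a -> computes (I := I) env v b -> a = b.
Proof.
move=> hG ha; elim: ha b => {v a} [v x e|v c e|v f u a e hu _ IH] b hb.
- by case: hb e => {v b} [v y ->|v c ->|v f u a -> _ _] // [->].
- by case: hb e => {v b} [v y ->|v y ->|v f u a -> _ _] // [->].
case: hb e hu IH => {v b} [v y ->|v y ->|v g u' a' eg hu' ha'] // e.
move: e; rewrite {1}eg => -[e]; subst g => hu IH.
congr op_value; apply: eq_from_tnth => i; apply: IH.
suff -> : tnth u i = tnth u' i by [].
have hi : i < label_arity (node_label v) by rewrite eg.
have [w [_ hw]] := eg_operand hG hi.
by rewrite -(hw _ (hu i)) -(hw _ (hu' i)).
Qed.

(* On an expression graph the relation [output] is a function of the input. *)
Lemma output_exists_unique Sg (I : interpretation Sg) (G : graph Sg)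
    (env : var Sg -> value I) :
  expr_graph G -> exists! a, output G env a.
Proof.
move=> hG; pose r : nodes G := FSetSub (eg_root hG).
have [a ha] := computes_exists env r hG.
exists a; split; first by exists r.
move=> b [s es hb]; have e : s = r by apply: val_inj.
by rewrite e in hb; apply: computes_unique hG ha hb.
Qed.

(* G_P is the rooted digraph on [pnode] whose arcs are the pairs with nonempty
   [Me]; an element of [Me p q] is an operand position of q. *)
Record pattern (A : Type) := Pattern {
  pnode : finType;
  proot : pnode;
  Mn : pnode -> A;
  Me : pnode -> pnode -> {fset nat} }.

Arguments proot {A} p.

(* The last conjunct places the match inside the subgraph rooted at n; the
   equality of edge sets forbids further edges between matched nodes. *)
Definition matches (Sg : signature) (P : pattern (pred (label Sg)))
    (G : graph Sg) (n : nat) (h : {ffun pnode P -> nodes G}) : bool :=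
  [&& val (h (proot P)) == n,
      injectiveb h,
      [forall p, Mn p (node_label (h p))],
      [forall p, forall q, Me p q == positions G (val (h p)) (val (h q))] &
      [forall p, connect (@adj _ G) (h p) (h (proot P))]].

Record match_pattern (Sg : signature) := MatchPattern {
  mp_pattern :> pattern (pred (label Sg));
  mp_deterministic : forall (G : graph Sg) n (h h' : {ffun pnode mp_pattern -> nodes G}),
    expr_graph G -> matches n h -> matches n h' -> h = h' }.

Definition match_succeeds (Sg : signature) (P : match_pattern Sg)
    (G : graph Sg) (n : nat) : bool :=
  [exists h : {ffun pnode P -> nodes G}, matches n h].

(* A node output by a rewrite is either a matched node, or a new node whose label
   may depend on the labels of the matched nodes. *)
Inductive node_output (Sg : signature) (T : Type) :=
| Kept of T
| New of ((T -> label Sg) -> label Sg).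

Definition replace_pattern (Sg : signature) (P : match_pattern Sg) :=
  pattern (node_output Sg (pnode P)).

Record rewrite_rule (Sg : signature) := RewriteRule {
  Pmatch : match_pattern Sg;
  Preplace : replace_pattern Pmatch }.

(* Removes the nodes from which the root cannot be reached. *)
Definition prune (Sg : signature) (G : graph Sg) : graph Sg :=
  Graph (out_root G) (lab G).[& live G]
        [fset e in edges G | (e.1.1 \in live G) && (e.1.2 \in live G)].

Section Application.
Variables (Sg : signature) (A : rewrite_rule Sg) (G : graph Sg).
Variable h : {ffun pnode (Pmatch A) -> nodes G}.

Definition fresh : nat := (\max_(v : nodes G) val v).+1.

Definition new_id (q : pnode (Preplace A)) : nat :=
  if Mn q is Kept p then val (h p) else fresh + enum_rank q.

Definition new_lab : {fmap nat -> label Sg} :=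
  foldr (fun q (L : {fmap nat -> label Sg}) =>
           if Mn q is New l then L.[new_id q <- l (fun p => node_label (h p))]
           else L)
        (lab G) (enum (pnode (Preplace A))).

Definition new_edges : {fset nat * nat * nat} :=
  \bigcup_(p <- enum (pnode (Preplace A)))
    \bigcup_(q <- enum (pnode (Preplace A)))
      [fset (new_id p, new_id q, i) | i in Me p q].

(* Every use of the value of the matched root is redirected to the root of the
   replacement.  Other matched nodes may have consumers outside the match; they
   are left in place, and [prune] removes those that are no longer used. *)
Definition replace_match : graph Sg :=
  let n := val (h (proot (Pmatch A))) in
  let n' := new_id (proot (Preplace A)) in
  prune (Graph
    (if out_root G == n then n' else out_root G)
    new_lab
    ([fset (if e.1.1 == n then (n', e.1.2, e.2) else e) | e in edges G]
       `|` new_edges)).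

End Application.

Definition apply (Sg : signature) (A : rewrite_rule Sg) (n : nat)
    (G : graph Sg) : option (graph Sg) :=
  omap (@replace_match Sg A G)
    [pick h : {ffun pnode (Pmatch A) -> nodes G} | matches n h].

Record axiom_of_equivalence (Sg : signature) (I : interpretation Sg) :=
  AxiomOfEquivalence {
    ax_rule :> rewrite_rule Sg;
    ax_sound : forall (G : graph Sg) n,
      expr_graph G -> match_succeeds (Pmatch ax_rule) G n ->
      exists2 G', apply ax_rule n G = Some G' & equivalent I G G' }.

(* The sequence A_1(n_1, A_2(n_2, ... A_m(n_m, G))) is the list of pairs
   (A_1, n_1), ..., (A_m, n_m), so its last pair is applied first. *)
Section Composition.
Variables (Sg : signature) (I : interpretation Sg).

Fixpoint apply_seq (S : seq (axiom_of_equivalence I * nat)) (G : graph Sg) :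
    option (graph Sg) :=
  if S is (A, n) :: S' then obind (apply A n) (apply_seq S' G) else Some G.

Fixpoint semantics_preserving_composition
    (S : seq (axiom_of_equivalence I * nat)) (G : graph Sg) : Prop :=
  if S is (A, n) :: S' then
    semantics_preserving_composition S' G /\
    exists Gi Gj, [/\ apply_seq S' G = Some Gi,
                      match_succeeds (Pmatch A) Gi n &
                      apply A n Gi = Some Gj]
  else True.

End Composition.

(* Main.v *)
Require Import Defs.
From mathcomp Require Import all_boot finmap.

(** Soundness of one axiom application is part of the notion of axiom ([ax_sound]), so equivalences
    are chained along [S] by transitivity. The induction is on [S], whose head is the application
    performed last: the induction hypothesis covers everything before it. *)

Lemma equivalent_refl (Sg : signature) (I : interpretation Sg) (G : graph Sg) :
  expr_graph G -> equivalent I G G.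
Proof. by split. Qed.

Lemma equivalent_trans (Sg : signature) (I : interpretation Sg)
    (G1 G2 G3 : graph Sg) :
  equivalent I G1 G2 -> equivalent I G2 G3 -> equivalent I G1 G3.
Proof.
move=> [hG1 _ h12] [_ hG3 h23]; split=> // env henv a.
exact: iff_trans (h12 env henv a) (h23 env henv a).
Qed.

Theorem theorem3p7 (Sg : signature) (I : interpretation Sg)
    (S : seq (axiom_of_equivalence I * nat)) (G G' : graph Sg)
    (hG : expr_graph G)
    (hS : semantics_preserving_composition S G)
    (hG' : apply_seq S G = Some G') :
  equivalent I G G'.
Proof.
elim: S G' hS hG' => [|[A n] S IH] G' /=.
  by move=> _ [<-]; apply: equivalent_refl.
move=> [hS [Gi [_ [eGi hmatch _]]]]; rewrite eGi /= => eG'.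
(* [equivalent] also records that [Gi] is an expression graph, which [ax_sound] requires. *)
have hGi := IH Gi hS eGi; have [_ hi _] := hGi.
have [Gj eGj hij] := ax_sound hi hmatch.
(* [apply] is a function, so the graph given by [ax_sound] is the actual result. *)
have <- : Gj = G' by move: eG'; rewrite eGj => -[].
exact: equivalent_trans hGi hij.
Qed.
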